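(* Let $k\geq 1$, $t\geq 1$ be integers, let $g(k,t)=\max\{21tk-3k+6,\,24k-12\}$, and let $n\geq 28t^2k^3$ be an integer. If $G$ is a connected graph with $n$ vertices, at most $n\left(1+\frac{1}{g(k,t)}\right)$ edges and $\alpha'(G)=\alpha'$, then $$r(G,tK_{1,k})\leq \max\{n,\,n+k-1-\alpha'\}+t-1.$$ In particular, if $\alpha'\geq k-1$, then $r(G,tK_{1,k})=n+t-1$.
   Context: All graphs are finite and simple. For a graph $G$ and a vertex $v\in V(G)$, $N(v)$ is the set of neighbours of $v$, $N[v]=N(v)\cup\{v\}$, and $G_v=G-N[v]$ is the graph obtained from $G$ by deleting all vertices of $N[v]$. The independence number $\alpha(H)$ of a graph $H$ is the maximum size of an independent set (so it is $0$ if $H$ has no vertices). Define $\alpha'(G)=\min\{\alpha(G_v): v\in V(G)\}$. $K_{1,k}$ is the star on $k+1$ vertices and $tK_{1,k}$ is the disjoint union of $t$ copies of $K_{1,k}$. For graphs $G,H$, the Ramsey number $r(G,H)$ is the smallest positive integer $N$ such that for every graph $F$ on $N$ vertices, either $G$ is a (not necessarily induced) subgraph of $F$ or $H$ is a (not necessarily induced) subgraph of the complement $\overline{F}$; equivalently, every red-blue edge-coloring of $K_N$ contains a red copy of $G$ or a blue copy of $H$. *)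

(* Defs.v *)
From HB Require Import structures.
From mathcomp Require Import all_boot all_order all_algebra.
From mathcomp Require Import boolp.

Set Implicit Arguments.
Unset Strict Implicit.
Unset Printing Implicit Defensive.

Record sgraph := SGraph {
  vertex :> finType;
  adj : rel vertex;
  adj_sym : symmetric adj;
  adj_irr : irreflexive adj
}.

Definition edges (G : sgraph) : {set {set G}} :=
  [set [set p.1; p.2] | p : G * G & adj p.1 p.2].

Definition connected (G : sgraph) : Prop :=
  forall x y : G, connect (@adj G) x y.

Definition nbhd (G : sgraph) (v : G) : {set G} := [set x | adj v x].

Definition cnbhd (G : sgraph) (v : G) : {set G} := v |: nbhd v.

Section Induced.
Variables (G : sgraph) (A : {set G}).
Let adjI : rel {x : G | x \in A} := fun x y => adj (val x) (val y).
Fact adjI_sym : symmetric adjI. Proof. by move=> x y; apply: adj_sym. Qed.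
Fact adjI_irr : irreflexive adjI. Proof. by move=> x; apply: adj_irr. Qed.
Definition induced : sgraph := SGraph adjI_sym adjI_irr.
End Induced.

Definition del_cnbhd (G : sgraph) (v : G) : sgraph := induced (~: cnbhd v).

Definition stable (G : sgraph) (S : {set G}) : bool :=
  [forall x in S, forall y in S, ~~ adj x y].

Definition alpha (G : sgraph) : nat := \max_(S : {set G} | stable S) #|S|.

(* Every alpha (del_cnbhd v) is at most #|G|, so the default value #|G| of
   the iterated minimum is harmless as soon as G has a vertex. *)
Definition alpha' (G : sgraph) : nat :=
  \big[minn/#|G|]_(v : G) alpha (del_cnbhd v).

Section Complement.
Variable G : sgraph.
Let adjC : rel G := fun x y => (x != y) && ~~ adj x y.
Fact adjC_sym : symmetric adjC.
Proof. by move=> x y; rewrite /adjC eq_sym adj_sym. Qed.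
Fact adjC_irr : irreflexive adjC. Proof. by move=> x; rewrite /adjC eqxx. Qed.
Definition compl : sgraph := SGraph adjC_sym adjC_irr.
End Complement.

Section Star.
Variable k : nat.
(* The center is None, the leaves are Some i. *)
Let adjS : rel (option 'I_k) := fun x y => isSome x (+) isSome y.
Fact adjS_sym : symmetric adjS. Proof. by move=> x y; apply: addbC. Qed.
Fact adjS_irr : irreflexive adjS. Proof. by move=> x; apply: addbb. Qed.
Definition star : sgraph := SGraph adjS_sym adjS_irr.
End Star.

Section Copies.
Variables (t : nat) (H : sgraph).
Let adjD : rel ('I_t * H)%type :=
  fun p q => (p.1 == q.1) && adj p.2 q.2.
Fact adjD_sym : symmetric adjD.
Proof. by move=> p q; rewrite /adjD eq_sym adj_sym. Qed.
Fact adjD_irr : irreflexive adjD.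
Proof. by move=> p; rewrite /adjD adj_irr andbF. Qed.
Definition copies : sgraph := SGraph adjD_sym adjD_irr.
End Copies.

Definition subgraph (G F : sgraph) : Prop :=
  exists f : G -> F, injective f /\ forall x y, adj x y -> adj (f x) (f y).

Definition ramsey_prop (G H : sgraph) (N : nat) : Prop :=
  0 < N /\
  forall F : sgraph, #|F| = N -> subgraph G F \/ subgraph H (compl F).

Lemma ramsey_set (a b : nat) : exists N, forall (F : sgraph) (A : {set F}),
  N <= #|A| ->
  (exists S : {set F}, [/\ S \subset A, #|S| = a
     & {in S &, forall x y, x != y -> adj x y}]) \/
  (exists S : {set F}, [/\ S \subset A, #|S| = b
     & {in S &, forall x y, x != y -> ~~ adj x y}]).
Proof.
have [m] := ubnP (a + b); elim: m a b => // m IH [|a] [|b] lt_m.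
- by exists 0 => F A _; left; exists set0; split;
    rewrite ?sub0set ?cards0 // => x y; rewrite inE.
- by exists 0 => F A _; left; exists set0; split;
    rewrite ?sub0set ?cards0 // => x y; rewrite inE.
- by exists 0 => F A _; right; exists set0; split;
    rewrite ?sub0set ?cards0 // => x y; rewrite inE.
have [N1 P1] := IH a b.+1 lt_m.
have [|N2 P2] := IH a.+1 b; first by rewrite addSnnS.
exists (N1 + N2).+1 => F A leA.
have /card_gt0P[v Av] : 0 < #|A| by exact: leq_trans leA.
pose B := [set x in A :\ v | adj v x]; pose C := [set x in A :\ v | ~~ adj v x].
have defBC : #|A :\ v| = #|B| + #|C|.
  rewrite -(cardsID [set x | adj v x] (A :\ v)); congr (_ + _);
    by apply: eq_card => x; rewrite !inE // andbC.
have sBA : B \subset A by apply/subsetP=> x; rewrite !inE => /andP[/andP[]].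
have sCA : C \subset A by apply/subsetP=> x; rewrite !inE => /andP[/andP[]].
have /orP[/P1[]|/P2[]]: (N1 <= #|B|) || (N2 <= #|C|).
- rewrite leqNgt (leqNgt N2) -negb_and; apply/negP => /andP[lt1 lt2].
  move: leA; rewrite (cardsD1 v A) Av defBC add1n ltnS leqNgt.
  by rewrite -addnS leq_add // ltnW.
- case=> S [sSB cS clS]; left; exists (v |: S); split.
  + by rewrite subUset sub1set Av (subset_trans sSB).
  + by rewrite cardsU1 cS; case: (boolP (v \in S)) => // /(subsetP sSB);
      rewrite !inE eqxx.
  + move=> x y /setU1P[->|Sx] /setU1P[->|Sy]; rewrite ?eqxx //.
    * by move: (subsetP sSB _ Sy); rewrite !inE => /andP[].
    * by move: (subsetP sSB _ Sx); rewrite !inE adj_sym => /andP[].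
    * exact: clS.
- case=> S [sSB cS clS]; right; exists S; split=> //.
  exact: subset_trans sBA.
- case=> S [sSC cS clS]; left; exists S; split=> //.
  exact: subset_trans sCA.
- case=> S [sSC cS clS]; right; exists (v |: S); split.
  + by rewrite subUset sub1set Av (subset_trans sSC).
  + by rewrite cardsU1 cS; case: (boolP (v \in S)) => // /(subsetP sSC);
      rewrite !inE eqxx.
  + move=> x y /setU1P[->|Sx] /setU1P[->|Sy]; rewrite ?eqxx //.
    * by move: (subsetP sSC _ Sy); rewrite !inE => /andP[].
    * by move: (subsetP sSC _ Sx); rewrite !inE adj_sym => /andP[].
    * exact: clS.
Qed.

Lemma subgraph_clique (G F : sgraph) (S : {set F}) : #|S| = #|G| ->
  {in S &, forall x y, x != y -> adj x y} -> subgraph G F.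
Proof.
move=> cS clS; pose f (x : G) : F := enum_val (cast_ord (esym cS) (enum_rank x)).
have inj_f : injective f.
  by move=> x y /enum_val_inj /cast_ord_inj /enum_rank_inj.
exists f; split=> // x y xy; apply: clS; rewrite ?enum_valP //.
by apply: contraTneq xy => /inj_f ->; rewrite adj_irr.
Qed.

Lemma ramsey_exists (G H : sgraph) : exists N, `[< ramsey_prop G H N >].
Proof.
have [N P] := ramsey_set #|G| #|H|.
exists N.+1; apply/asboolP; split=> // F cF.
have [|[S [_ cS clS]]|[S [_ cS clS]]] := P F setT; first by rewrite cardsT cF leqnSn.
- by left; apply: subgraph_clique cS clS.
- right; apply: (@subgraph_clique H (compl F) S cS) => x y Sx Sy xy.
  by rewrite /= xy clS.
Qed.

Definition ramsey (G H : sgraph) : nat := ex_minn (ramsey_exists G H).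

(* For k, t >= 1 both truncated subtractions are exact. *)
Definition g (k t : nat) : nat :=
  maxn (21 * t * k - 3 * k + 6) (24 * k - 12).

(* Main.v *)
Require Import Defs.
From mathcomp Require Import all_boot all_order all_algebra.
From mathcomp Require Import boolp.
From mathcomp Require Import zify lra.

Set Implicit Arguments.
Unset Strict Implicit.
Unset Printing Implicit Defensive.
Import GRing.Theory Num.Theory.

(** The idea. Write B for the blue graph, the complement of the red graph F. A
    red copy of G is a packing of G with B: an injection that sends no edge of G
    to an edge of B.

    The upper bound is by induction on t. A vertex with at least t(k+1)-1 blue
    neighbours can be deleted: t-1 disjoint blue stars in the rest use up only
    (t-1)(k+1) vertices, so they leave it k blue neighbours, hence a t-th star.
    Otherwise all blue degrees are below t(k+1)-1, and a maximal family of
    disjoint blue stars covers a set S of at most (t-1)(k+1) vertices whose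
    removal leaves a blue graph with degrees at most k-1. The troublesome set S
    together with its blue neighbourhood has only O(t^2 k^2) vertices, and G can
    be packed ([pack_sparse]).

    The packing of G is greedy in order of decreasing degree
    ([pack_greedy_sparse]). As G has about n edges, the (j+1)-st vertex has
    degree at most about 2n/j, so the blue neighbours of the images of its
    neighbours never exhaust the room, until only a few vertices of G are left.
    To use the last points of the host as well, S included, a set of vertices of
    degree at most 2 is kept for the end. There are two ways.

    - Some v has many neighbours of degree 1 ([pack_of_hub]). Map v to a point x
      outside S with no blue neighbour in S. The at most k-1 blue neighbours of
      x are unusable for those leaves, so they are covered first, by an
      independent set of G_v: this is where alpha' enters, and why max(0,
      k-1-alpha') additional points are sometimes needed. After the greedy phase
      the leaves of v go to arbitrary free points.

    - There is a large independent set L of vertices of degree at most 2, of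
      which every vertex of G sees few ([pack_of_stable]). The neighbours of L
      are placed first, at points with no blue neighbour in S, then the rest
      greedily outside S, and finally L one vertex at a time, exchanging two
      vertices of L when the only free points are forbidden ([pack_absorb]).

    If no v has many leaves, L can be made of leaves when there are enough of
    them; otherwise most vertices of G have degree 2 and neighbours of
    degree at most 2, because the sum of deg - 2 over G is small, and L is an
    independent set of such vertices ([sparse_stable]).

    The edge bound is used as follows: since g(k,t) >= 24, there are at most
    25n/24 edges, that is, the degrees sum to at most 50n/24.

    The lower bound is the red graph on n+t-2 vertices made of two disjoint
    cliques on n-1 and t-1 vertices: each blue star has a vertex in the second
    clique ([ramsey_lower]). *)

(** * Packing one vertex at a time *)

(** With H the blue graph, a red copy of the part of G induced by D. Partial
    maps are total functions whose values outside D carry no information. *)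
Definition pack (G H : sgraph) (D : {set G}) (f : G -> H) : Prop :=
  {in D &, injective f} /\
  {in D &, forall x y, adj x y -> ~~ adj (f x) (f y)}.

Lemma pack_sub (G H : sgraph) (D E : {set G}) (f : G -> H) :
  D \subset E -> pack E f -> pack D f.
Proof.
move=> /subsetP sDE [injf redf]; split=> x y /sDE Ex /sDE Ey;
  [exact: injf | exact: redf].
Qed.

Lemma pack_extend (G H : sgraph) (D : {set G}) (f : G -> H) (w : G) (y : H) :
  pack D f -> w \notin D -> y \notin f @: D ->
  {in D, forall z, adj z w -> ~~ adj (f z) y} ->
  pack (w |: D) [eta f with w |-> y].
Proof.
move=> [injf redf] wD yfD redy.
have neq x : x \in D -> (x == w) = false.
  by move=> Dx; apply: contraNF wD => /eqP <-.
have fneq x : x \in D -> f x <> y.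
  by move=> Dx fxy; case/imsetP: yfD; exists x.
split=> x1 x2 /setU1P[->|Dx1] /setU1P[->|Dx2] //=;
  rewrite ?eqxx ?neq //.
- by move=> /esym /fneq; case.
- by move=> /fneq; case.
- exact: injf.
- by rewrite adj_irr.
- by rewrite adj_sym [adj y _]adj_sym; apply: redy.
- exact: redy.
- exact: redf.
Qed.

Lemma card_bigcup_leq (I T : finType) (P : {set I}) (F : I -> {set T}) (K : nat) :
  {in P, forall i, #|F i| <= K} -> #|\bigcup_(i in P) F i| <= K * #|P|.
Proof.
move=> leFK; rewrite mulnC -sum_nat_const.
elim/big_rec2: _ => [|i m A Pi leAm]; first by rewrite cards0.
by apply: leq_trans (leq_card_setU _ _) _; rewrite leq_add ?leFK.
Qed.

(** An already placed neighbour of w forbids for w at most K points of Y, and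
    the others forbid none but their own image; so the greedy choice goes
    through as long as these numbers add up to less than the size of Y. Keeping
    a set X free as well serves to steer the images away from prescribed
    points. *)
Lemma pack_greedy (G H : sgraph) (K : nat) (Y X : {set H}) (A : {set G})
    (f : G -> H) (ws : seq G) :
  {in Y, forall y, #|nbhd y :&: Y| <= K} ->
  pack A f -> {in A, forall x, f x \in Y} ->
  uniq ws -> {in ws, forall w, w \notin A} ->
  (forall us w vs, ws = us ++ w :: vs ->
    #|X :|: f @: A| + size us + K * #|nbhd w :&: (A :|: [set:: us])| < #|Y|) ->
  exists f' : G -> H, [/\ pack (A :|: [set:: ws]) f', {in A, f' =1 f} &
    {in ws, forall w, f' w \in Y :\: X}].
Proof.
move=> degY packA fAY; elim/last_ind: ws => [|ws w IH] uniq_ws disj room.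
  by exists f; split=> //; rewrite set_nil setU0.
move: uniq_ws; rewrite rcons_uniq => /andP[w_ws uniq_ws].
have [||us w' vs eq_ws|f1 [pack1 f1A f1Y]] := IH; first by [].
- by move=> x wsx; apply: disj; rewrite mem_rcons inE wsx orbT.
- by apply: (room _ _ (rcons vs w)); rewrite eq_ws rcons_cat.
set D := A :|: [set:: ws] in pack1 *.
have f1DY x : x \in D -> f1 x \in Y.
  rewrite !inE => /orP[Ax|/f1Y]; first by rewrite f1A // fAY.
  by rewrite inE => /andP[].
have w_D : w \notin D by rewrite !inE negb_or w_ws disj // mem_rcons mem_head.
pose N := nbhd w :&: D.
pose Bad := X :|: f1 @: D :|: \bigcup_(z in N) (nbhd (f1 z) :&: Y).
have f1D : f1 @: D = f @: A :|: f1 @: [set:: ws].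
  by rewrite imsetU (eq_in_imset f1A).
have leBad : #|Bad| < #|Y|.
  apply: leq_ltn_trans (room ws w [::] _); last by rewrite cats1.
  apply: leq_trans (leq_card_setU _ _) _; apply: leq_add.
    rewrite f1D setUA; apply: leq_trans (leq_card_setU _ _) _.
    rewrite leq_add2l; apply: leq_trans (leq_imset_card _ _) _.
    by rewrite cardsE; apply: card_size.
  by apply: card_bigcup_leq => z; rewrite inE => /andP[_ /f1DY /degY].
have [y Yy Bady] : exists2 y, y \in Y & y \notin Bad.
  by apply/subsetPn; apply: contraL leBad => /subset_leq_card; rewrite -leqNgt.
move: Bady; rewrite !inE !negb_or -!andbA => /and3P[Xy f1Dy Ny].
exists [eta f1 with w |-> y]; split.
- have -> : A :|: [set:: rcons ws w] = w |: D.
    by apply/setP=> x; rewrite !inE mem_rcons inE orbCA.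
  apply: pack_extend => // z Dz zw; apply: contra Ny => zy.
  by apply/bigcupP; exists z; [rewrite inE Dz inE adj_sym zw | rewrite !inE zy].
- move=> x Ax /=; case: eqP => [xw|_]; last exact: f1A.
  by move: w_D; rewrite -xw !inE Ax.
- move=> x; rewrite mem_rcons inE /= => /orP[->|wsx]; first by rewrite inE Xy.
  by case: eqP => [_|_]; [rewrite inE Xy | apply: f1Y].
Qed.

(** The room for placing a vertex of degree d with b neighbours already placed,
    when j vertices were placed before it by decreasing degree (whence the
    bound on [j.+1 * d]) and p points were lost at the outset. If j < n/2k, the
    trivial bound b <= p + j is enough. If not, d is at most 25k/6, while d > 3
    bounds j by 25n/48, so that nearly half of the room is still there. The
    case d <= 3, the only one left near the end, is a hypothesis: there it is
    the number of vertices kept for later that makes room. *)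
Lemma greedy_room (k n p j d b : nat) :
  0 < k -> 28 * k ^ 3 <= n -> 7 * (k * p) <= 2 * n ->
  b <= d -> b <= p + j -> 24 * (j.+1 * d) <= 50 * n ->
  (d <= 3 -> p + j + 3 * k.-1 < n) -> p + j + k.-1 * b < n.
Proof.
move=> k0 kn pn bd bpj dn small.
have [d3|d4] := leqP d 3.
  apply: leq_ltn_trans (small d3); rewrite leq_add2l mulnC leq_mul2r.
  by rewrite (leq_trans bd d3) orbT.
have j_n : 96 * j.+1 <= 50 * n.
  by have : j.+1 * 4 <= j.+1 * d; [rewrite leq_mul2l d4 orbT | lia].
(* Few vertices placed: every placed vertex may be a neighbour. *)
have [early|late] := ltnP (2 * (k * j)) n.
  have : p + j + k.-1 * b <= k * (p + j).
    by rewrite -{2}(prednK k0) mulSn leq_add2l leq_mul2l bpj orbT.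
  by rewrite mulnDr; lia.
have b_k : 6 * b <= 25 * k.
  have bj : j * b <= j.+1 * d by rewrite leq_mul // ltnW.
  have n0 : 0 < n by case: (k) k0 kn => // i _; rewrite !expnS; lia.
  rewrite -(@leq_pmul2r (4 * n)) ?muln_gt0 //.
  have bn : n * b <= 2 * (k * j) * b by rewrite leq_mul2r late orbT.
  have kbj : k * (24 * (j * b)) <= k * (50 * n) by rewrite leq_mul2l; lia.
  lia.
have kk : 28 * (k.-1 * k) <= n.
  apply: leq_trans kn; rewrite leq_mul2l /= !expnS expn0.
  by apply: leq_mul; rewrite ?leq_pred // leq_pmulr // muln1.
have p_n : 7 * p <= 2 * n by apply: leq_trans pn; rewrite leq_mul2l leq_pmull.
have : 6 * (k.-1 * b) <= 25 * (k.-1 * k).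
  by rewrite mulnCA [25 * _]mulnCA leq_mul2l b_k orbT.
lia.
Qed.

(** Decreasing degree is the right order: a vertex of large degree comes when
    few vertices are placed, so it has few neighbours among them, and a vertex
    that comes late has small degree. Here p accounts for all points that are
    unavailable before the first new vertex is placed, relative to a host of n
    points. *)
Lemma pack_greedy_sparse (G H : sgraph) (k n p : nat) (Y X : {set H})
    (A W : {set G}) (f : G -> H) :
  0 < k -> 28 * k ^ 3 <= n -> 24 * (\sum_(v : G) #|nbhd v|) <= 50 * n ->
  {in Y, forall y, #|nbhd y :&: Y| <= k.-1} ->
  pack A f -> {in A, forall x, f x \in Y} -> [disjoint A & W] ->
  n + #|X :|: f @: A| <= #|Y| + p -> #|A| <= p ->
  7 * (k * p) <= 2 * n -> p + #|W| + 3 * k.-1 <= n ->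
  exists f' : G -> H, [/\ pack (A :|: W) f', {in A, f' =1 f} &
    {in W, forall w, f' w \in Y :\: X}].
Proof.
move=> k0 kn sparse degY packA fAY disj roomX Ap pn Wn.
pose leD (x y : G) := #|nbhd y| <= #|nbhd x|.
pose ws := sort leD (enum W).
have memws x : (x \in ws) = (x \in W) by rewrite mem_sort mem_enum.
have uniqws : uniq ws by rewrite sort_uniq enum_uniq.
have eqW : [set:: ws] = W by apply/setP=> x; rewrite inE memws.
have disjw w : w \in ws -> w \notin A.
  by rewrite memws => Ww; apply/negP=> Aw; move/disjointFr: disj => /(_ w Aw);
    rewrite Ww.
have [us w vs eq_ws|f' [packf' f'A f'W]] :=
    @pack_greedy G H k.-1 Y X A f ws degY packA fAY uniqws disjw.
  have tot : total leD by move=> x y; apply: leq_total.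
  have tr : transitive leD by move=> y x z xy yz; apply: leq_trans yz xy.
  have /allrelP bigger : allrel leD us (w :: vs).
    have : pairwise leD ws by rewrite -sorted_pairwise // sort_sorted.
    by rewrite eq_ws pairwise_cat => /andP[].
  have usW : size us < #|W|.
    have -> : #|W| = size ws by rewrite size_sort cardE.
    by rewrite eq_ws size_cat /= addnS ltnS leq_addr.
  pose b := #|nbhd w :&: (A :|: [set:: us])|.
  suff : p + size us + k.-1 * b < n by rewrite /b; lia.
  apply: (@greedy_room k n p (size us) #|nbhd w|) => //.
  - by apply: subset_leq_card; apply: subsetIl.
  - apply: leq_trans (subset_leq_card (subsetIr _ _)) _.
    apply: leq_trans (leq_card_setU _ _) _; apply: leq_add => //.
    by rewrite cardsE card_size.
  - apply: leq_trans sparse; rewrite leq_mul2l /=.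
    have uniq_uw : uniq (w :: us).
      move: uniqws; rewrite eq_ws -cat1s catA cat_uniq => /andP[+ _].
      by rewrite -(perm_uniq (permEl (perm_catC [:: w] us))).
    have -> : (size us).+1 * #|nbhd w| = \sum_(v <- w :: us) #|nbhd w|.
      by rewrite big_const_seq count_predT iter_addn_0 mulnC.
    rewrite [X in _ <= X](bigID (mem (w :: us)) predT) /=.
    apply: leq_trans (leq_addr _ _).
    rewrite -[X in _ <= X]big_uniq //= big_seq_cond [X in _ <= X]big_seq_cond.
    apply: leq_sum => v /andP[+ _]; rewrite inE => /orP[/eqP->//|usv].
    by apply: bigger; rewrite ?mem_head.
  - by move=> _; lia.
by exists f'; rewrite -eqW; split=> // w; rewrite inE => /f'W.
Qed.

(** * Absorbing the last vertices by exchanges *)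

(** The obstacle to placing u at y, read off from the images of the neighbours
    of u: the value of f at u itself is irrelevant, so the vertices of an
    independent set can be moved around without changing each other's clashes. *)
Definition clash (G H : sgraph) (f : G -> H) (u : G) (y : H) : bool :=
  [exists z, adj z u && adj (f z) y].

Lemma clash_eq_in (G H : sgraph) (f f' : G -> H) (D : {set G}) (u : G) (y : H) :
  nbhd u \subset D -> {in D, f' =1 f} -> clash f' u y = clash f u y.
Proof.
move=> /subsetP uD ff'; apply: eq_existsb => z.
by have [zu|//] := boolP (adj z u); rewrite ff' // uD // inE adj_sym.
Qed.

Lemma pack_extend_clash (G H : sgraph) (D : {set G}) (f : G -> H) (w : G)
    (y : H) :
  pack D f -> w \notin D -> y \notin f @: D -> ~~ clash f w y ->
  pack (w |: D) [eta f with w |-> y].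
Proof.
move=> packf wD yf /existsPn ok; apply: pack_extend => // z _ zw.
by have := ok z; rewrite zw.
Qed.

(** A weak form of Hall's theorem, proved by exchanges. If every free point
    clashes with u, there are at most a free points, so all but a vertices of L
    are placed. Then some w in L is at a point that suits u, and w itself
    suits a free point y, since at most a + c vertices of L fail one of these.
    Move w to y and put u in its place. *)
Lemma pack_absorb (G H : sgraph) (U : {set H}) (L : {set G}) (f : G -> H)
    (a c : nat) :
  stable L -> #|G| <= #|U| -> pack (~: L) f -> {in ~: L, forall x, f x \in U} ->
  {in L, forall u, #|[set y in U | clash f u y]| <= a} ->
  {in U, forall y, #|[set u in L | clash f u y]| <= c} ->
  2 * a + c < #|L| ->
  exists f' : G -> H, pack setT f' /\ forall x, f' x \in U.
Proof.
move=> /'forall_in_'forall_in_negP stL GU packf fU clashU clashL bigL.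
have nbL u : u \in L -> nbhd u \subset ~: L.
  by move=> Lu; apply/subsetP=> z; rewrite !inE => uz; apply/negP=> /(stL u Lu).
suff main (L1 : {set G}) : L1 \subset L -> exists f' : G -> H,
    [/\ pack (~: L :|: L1) f', {in ~: L, f' =1 f} &
      {in ~: L :|: L1, forall x, f' x \in U}].
  have [f' []] := main L (subxx _); rewrite setUC setUCr => packf' _ f'U.
  by exists f'; split=> // x; apply: f'U; rewrite inE.
have [m] := ubnP #|L1|; elim: m L1 => // m IH L1 leL1 L1L.
have [->|[u L1u]] := set_0Vmem L1.
  by exists f; rewrite setU0.
have Lu : u \in L by apply: (subsetP L1L).
pose L0 := L1 :\ u; pose D := ~: L :|: L0.
have L0L : L0 \subset L by apply: subset_trans L1L; apply: subD1set.
have ltL0 : #|L0| < m by rewrite (cardsD1 u) L1u in leL1.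
have [f1 [pack1 f1f f1U]] := IH L0 ltL0 L0L.
rewrite -/D in pack1 f1U.
have uD : u \notin D by rewrite !inE Lu eqxx.
have uDE : u |: D = ~: L :|: L1 by rewrite setUCA setD1K.
have f1clash (w : G) (y : H) : w \in L -> clash f1 w y = clash f w y.
  by move=> Lw; apply: clash_eq_in (nbL w Lw) f1f.
have sNLD : ~: L \subset D by apply: subsetUl.
have cardD : #|D| = #|~: L| + #|L0|.
  rewrite cardsU; suff -> : ~: L :&: L0 = set0 by rewrite cards0 subn0.
  apply/setP=> x; rewrite in_setI in_setC in_set0.
  by have [/(subsetP L0L) ->|] := boolP (x \in L0); rewrite ?andbF.
have cardf1D : #|f1 @: D| = #|D| by apply: card_in_imset; case: pack1.
pose R := U :\: f1 @: D.
have cardR : #|R| + #|D| = #|U|.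
  rewrite -cardf1D addnC -(cardsID (f1 @: D) U); congr (_ + _).
  apply/eq_card=> y; rewrite inE andbC; case: imsetP => //= -[x Dx ->].
  by rewrite f1U.
have L0_L : #|L0| < #|L|.
  by apply: proper_card; apply/properP; split=> //; exists u => //; rewrite !inE eqxx.
have GL : #|~: L| + #|L| = #|G| by rewrite addnC cardsC.
have [/exists_inP[y Ry yu]|/exists_inPn noR] := boolP [exists y in R, ~~ clash f u y].
  exists [eta f1 with u |-> y]; rewrite -uDE.
  move: Ry; rewrite inE => /andP[yf1 Uy]; split.
  - by apply: pack_extend_clash => //; rewrite f1clash.
  - by move=> x NLx /=; case: eqP => [xu|_]; [rewrite inE xu Lu in NLx | apply: f1f].
  - by move=> x /setU1P[->|Dx] /=; rewrite ?eqxx //; case: eqP => // _; apply: f1U.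
have Ra : #|R| <= a.
  apply: leq_trans (clashU u Lu); apply: subset_leq_card; apply/subsetP=> y Ry.
  by have := noR y Ry; rewrite negbK inE => ->; case/setDP: Ry => ->.
have [y Ry] : exists y, y \in R by apply/set0Pn; rewrite -card_gt0; lia.
move: (Ry); rewrite inE => /andP[yf1 Uy].
pose Bad := [set w in L0 | clash f u (f1 w)] :|: [set w in L | clash f w y].
have BadL0 : #|Bad| < #|L0|.
  apply: leq_ltn_trans (leq_card_setU _ _) _.
  have : #|[set w in L0 | clash f u (f1 w)]| <= a.
    apply: leq_trans (clashU u Lu).
    rewrite -(@card_in_imset _ _ f1); last first.
      move=> x1 x2; rewrite inE => /andP[L1x _]; rewrite inE => /andP[L2x _].
      by apply: (proj1 pack1); rewrite inE ?L1x ?L2x orbT.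
    apply: subset_leq_card; apply/subsetP=> _ /imsetP[w + ->].
    rewrite 2!in_set => /andP[L0w ->].
    by rewrite f1U // in_setU L0w orbT.
  move: (clashL y Uy) bigL Ra GU cardR cardD GL; clear; lia.
have [w L0w wBad] : exists2 w, w \in L0 & w \notin Bad.
  by apply/subsetPn; apply: contraL BadL0 => /subset_leq_card; rewrite -leqNgt.
have Lw : w \in L by apply: (subsetP L0L).
have Dw : w \in D by rewrite inE L0w orbT.
move: wBad; rewrite in_setU [w \in finset _]in_set L0w.
rewrite [w \in finset _]in_set Lw /= negb_or => /andP[uw wy].
pose D' := D :\ w.
have wD' : w \notin D' by rewrite !inE eqxx.
have D'w : w |: D' = D by apply: setD1K.
pose f2 := [eta f1 with w |-> y].
have pack2 : pack D f2.
  rewrite -D'w; apply: pack_extend_clash => //.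
  - by apply: pack_sub pack1; apply: subD1set.
  - by apply: contra yf1; apply/subsetP; apply: imsetS; apply: subD1set.
  - by rewrite f1clash.
have f2f : {in ~: L, f2 =1 f}.
  by move=> x NLx /=; case: eqP => [xw|_]; [rewrite inE xw Lw in NLx | apply: f1f].
have f2U : {in D, forall x, f2 x \in U}.
  by move=> x Dx /=; case: eqP => // _; apply: f1U.
exists [eta f2 with u |-> f1 w]; rewrite -uDE; split.
- apply: pack_extend_clash => //; last first.
    by rewrite (clash_eq_in _ (nbL u Lu) f2f).
  apply/imsetP=> -[x Dx] /=; case: eqP => [_ f1wy|xw f1wx].
    by rewrite -f1wy imset_f in yf1.
  by case: xw; apply: (proj1 pack1).
- move=> x NLx; rewrite /= -/(f2 x) f2f //.
  by case: eqP => // xu; rewrite inE xu Lu in NLx.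
- move=> x /setU1P[->|Dx]; first by rewrite /= eqxx f1U.
  by have := f2U x Dx; rewrite /=; case: (x =P u) => // _ _; apply: f1U.
Qed.

Definition safe (H : sgraph) (U S : {set H}) : {set H} :=
  (U :\: S) :\: \bigcup_(x in S) (nbhd x :&: U).

Lemma safeP (H : sgraph) (U S : {set H}) (y : H) :
  y \in safe U S -> y \in U :\: S /\ {in S, forall x, ~~ adj x y}.
Proof.
rewrite inE => /andP[/bigcupP noS Yy]; split=> // x Sx; apply/negP=> xy.
apply: noS; exists x; rewrite // inE inE xy.
by move: Yy; rewrite inE => /andP[].
Qed.

(** Why the neighbours of the reserved vertices are placed at safe points: they
    then block no point of S, and at most k - 1 points elsewhere. *)
Lemma nbhd_safe (H : sgraph) (U S : {set H}) (y : H) :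
  y \in safe U S -> nbhd y :&: U = nbhd y :&: (U :\: S).
Proof.
move=> /safeP[_ noS]; apply/setP=> x; rewrite !inE.
have [/noS|//] := boolP (x \in S).
by rewrite adj_sym => /negbTE ->.
Qed.

(** The reserved set L makes all the points of U usable, those of S included:
    the vertices outside L avoid S, and L is absorbed by exchanges. The
    constant 4 + c comes from 2a + c' in the absorption, where a vertex of L
    has two neighbours, each blocking k - 1 points (a = 2(k-1)), and a point
    meets k - 1 images of neighbours of L, each with c neighbours in L. *)
Lemma pack_of_stable (G H : sgraph) (k l c : nat) (U S : {set H})
    (L : {set G}) :
  0 < k -> 28 * k ^ 3 <= #|G| ->
  24 * (\sum_(v : G) #|nbhd v|) <= 50 * #|G| ->
  #|G| <= #|U| -> S \subset U ->
  {in U :\: S, forall y, #|nbhd y :&: (U :\: S)| <= k.-1} ->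
  stable L -> #|L| = l -> {in L, forall u, #|nbhd u| <= 2} ->
  (forall w, #|nbhd w :&: L| <= c) ->
  #|S| + #|\bigcup_(x in S) (nbhd x :&: U)| + k * (2 * l) <= #|G| ->
  7 * (k * (#|S| + 2 * l)) <= 2 * #|G| -> #|S| + 3 * k.-1 <= l ->
  k.-1 * (4 + c) < l ->
  exists f : G -> H, pack setT f /\ forall x, f x \in U.
Proof.
move=> k0 kn sparse GU SU degY stL cardL deg2 cL room1 room2 roomS room3.
have stL' := stL; move/'forall_in_'forall_in_negP: stL' => stL'.
pose N := \bigcup_(u in L) nbhd u.
have N2l : #|N| <= 2 * l by rewrite -cardL; apply: card_bigcup_leq.
have NL : N \subset ~: L.
  apply/subsetP=> z /bigcupP[u Lu]; rewrite !inE => uz.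
  by apply/negP=> /(stL' u Lu).
have cardY : #|U :\: S| + #|S| = #|U|.
  by rewrite addnC -(cardsID S U) (setIidPr SU).
have n0 : 0 < #|G|.
  by apply: leq_trans kn; rewrite muln_gt0 expn_gt0 k0.
have [y0 _] : exists y, y \in U by apply/set0Pn; rewrite -card_gt0; lia.
have memN x : (x \in enum N) = (x \in N) by rewrite mem_enum.
have [||||us w vs eqN|f1 [pack1 _ f1N]] := @pack_greedy G H k.-1 (U :\: S)
    (\bigcup_(x in S) (nbhd x :&: U)) set0 (fun=> y0) (enum N) degY.
- by split=> x y; rewrite inE.
- by move=> x; rewrite inE.
- exact: enum_uniq.
- by move=> x _; rewrite inE.
- have usN : size us < #|N|.
    by rewrite cardE eqN size_cat /= addnS ltnS leq_addr.
  have back : k.-1 * #|nbhd w :&: (set0 :|: [set:: us])| <= k.-1 * size us.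
    rewrite leq_mul2l set0U (leq_trans (subset_leq_card (subsetIr _ _))) ?orbT //.
    by rewrite cardsE card_size.
  rewrite imset0 setU0.
  have : k * (size us).+1 <= k * (2 * l) by rewrite leq_mul2l; lia.
  have : size us + k.-1 * size us = k * size us by rewrite -mulSn prednK.
  rewrite mulnS; lia.
rewrite set0U in pack1.
have eqN : [set:: enum N] = N by rewrite set_enum.
rewrite eqN in pack1.
have {}f1N : {in N, forall w, f1 w \in safe U S}.
  by move=> w; rewrite -memN; apply: f1N.
have f1Y : {in N, forall w, f1 w \in U :\: S}.
  by move=> w /f1N /safeP[].
pose W := ~: L :\: N.
have cardW : #|N| + #|W| + l = #|G|.
  rewrite -cardL addnAC; have := cardsID N (~: L); rewrite (setIidPr NL).
  by have := cardsC L; rewrite -/W; lia.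
have [|||||f2 [pack2 f2f1 f2W]] := @pack_greedy_sparse G H k #|G| (#|S| + #|N|)
    (U :\: S) set0 N W f1 k0 kn sparse degY pack1 f1Y.
- by rewrite -setI_eq0 setIDA setIC setDE -setIA setICr setI0.
- by rewrite set0U; have := leq_imset_card f1 N; lia.
- exact: leq_addl.
- apply: leq_trans room2; rewrite leq_mul2l /= leq_mul2l leq_add2l N2l.
  by rewrite orbT.
- by lia.
have NW : N :|: W = ~: L by rewrite /W setDE setUIr setUCr setIT; apply/setUidPr.
rewrite NW in pack2.
have f2N : {in N, forall w, f2 w \in safe U S}.
  by move=> w Nw; rewrite f2f1 // f1N.
have f2U : {in ~: L, forall x, f2 x \in U}.
  move=> x; rewrite -NW => /setUP[/f2N /safeP[] | /f2W];
    by rewrite !inE => /andP[_] // /andP[].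
have nbN u z : u \in L -> adj z u -> z \in N.
  by move=> Lu zu; apply/bigcupP; exists u; rewrite // inE adj_sym.
apply: (@pack_absorb G H U L f2 (k.-1 * 2) (c * k.-1)) => //; last first.
- by rewrite cardL; lia.
- move=> y Uy; pose Z := [set z in N | adj (f2 z) y].
  have cardZ : #|Z| <= k.-1.
    have [Sy|Sy] := boolP (y \in S).
      rewrite (_ : Z = set0) ?cards0 //; apply/setP=> z; rewrite !inE.
      apply/negP=> /andP[/f2N /safeP[_ /(_ y Sy)]].
      by rewrite adj_sym => /negbTE ->.
    have Yy : y \in U :\: S by rewrite inE Sy.
    apply: leq_trans (degY y Yy); rewrite -(@card_in_imset _ _ f2); last first.
      move=> z1 z2; rewrite inE => /andP[/(subsetP NL) N1 _].
      by rewrite inE => /andP[/(subsetP NL) N2 _]; apply: (proj1 pack2).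
    apply: subset_leq_card; apply/subsetP=> _ /imsetP[z + ->].
    rewrite inE => /andP[/f2N /safeP[Yz _] zy].
    by rewrite inE Yz inE adj_sym zy.
  apply: leq_trans (_ : c * #|Z| <= _); last by rewrite leq_mul2l cardZ orbT.
  apply: leq_trans (card_bigcup_leq (F := fun z => nbhd z :&: L) _); last first.
    by move=> z _; apply: cL.
  apply: subset_leq_card; apply/subsetP=> u; rewrite inE.
  move=> /andP[Lu /existsP[z /andP[zu zy]]]; apply/bigcupP; exists z.
    by rewrite inE zy andbT (nbN u).
  by rewrite !inE zu.
- move=> u Lu; apply: leq_trans (_ : k.-1 * #|nbhd u| <= _); last first.
    by rewrite leq_mul2l deg2 ?orbT.
  apply: leq_trans (card_bigcup_leq (F := fun z => nbhd (f2 z) :&: U) _); last first.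
    move=> z; rewrite inE adj_sym => /(nbN u z Lu) /f2N safez.
    by rewrite (nbhd_safe safez) degY //; case/safeP: safez.
  apply: subset_leq_card; apply/subsetP=> y; rewrite inE.
  move=> /andP[Uy /existsP[z /andP[zu zy]]]; apply/bigcupP; exists z.
    by rewrite inE adj_sym.
  by rewrite !inE zy.
Qed.

(** * A vertex with many leaves *)

Lemma subset_of_card (T : finType) (A : {set T}) (m : nat) :
  m <= #|A| -> exists2 B : {set T}, B \subset A & #|B| = m.
Proof.
move=> /card_geqP[s [uniq_s <- sA]]; exists [set:: s].
  by apply/subsetP=> x; rewrite inE => /sA.
by rewrite cardsE; apply/card_uniqP.
Qed.

Lemma injection_into (T T' : finType) (y0 : T') (P : {set T}) (Q : {set T'}) :
  #|P| <= #|Q| ->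
  exists g : T -> T', {in P &, injective g} /\ {in P, forall x, g x \in Q}.
Proof.
move=> PQ; exists (fun x => nth y0 (enum Q) (index x (enum P))).
have idx x : x \in P -> index x (enum P) < size (enum Q).
  by move=> Px; rewrite -cardE (leq_trans _ PQ) // cardE index_mem mem_enum.
split=> [x1 x2 P1 P2 /eqP|x Px]; last by rewrite -mem_enum mem_nth ?idx.
rewrite nth_uniq ?enum_uniq ?idx // => /eqP.
by apply: (index_inj x1); rewrite mem_enum.
Qed.

Lemma stable_del_cnbhd (G : sgraph) (v : G) : exists I : {set G},
  [/\ stable I, #|I| = alpha (del_cnbhd v) & {in I, forall z, z \notin cnbhd v}].
Proof.
have : 0 < #|[pred S : {set del_cnbhd v} | stable S]|.
  apply/card_gt0P; exists set0; apply/'forall_in_'forall_in_negP => x.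
  by rewrite inE.
move=> /(eq_bigmax_cond (fun S : {set del_cnbhd v} => #|S|))[I0 stI0 maxI0].
exists (val @: I0); split.
- apply/'forall_in_'forall_in_negP => _ /imsetP[x Ix ->] _ /imsetP[y Iy ->].
  by move/'forall_in_'forall_in_negP: stI0 => /(_ x Ix y Iy).
- by rewrite /alpha maxI0 card_imset //; apply: val_inj.
- by move=> _ /imsetP[x _ ->]; have := valP x; rewrite inE.
Qed.

(** The leaves of v can be placed at any free point except the neighbours in H
    of the image x of v. An independent set of G_v is therefore mapped into
    these neighbours first; those it does not reach are wasted, which the
    hypothesis on alpha allows for. Each leaf is then free to take any
    remaining point, S included, since x is safe. *)
Lemma pack_of_hub (G H : sgraph) (k : nat) (U S : {set H}) (v : G)
    (T := [set u in nbhd v | #|nbhd u| <= 1]) :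
  0 < k -> 28 * k ^ 3 <= #|G| ->
  24 * (\sum_(v : G) #|nbhd v|) <= 50 * #|G| ->
  #|G| <= #|U| -> #|G| + k.-1 <= #|U| + alpha (del_cnbhd v) -> S \subset U ->
  {in U :\: S, forall y, #|nbhd y :&: (U :\: S)| <= k.-1} ->
  #|S| + #|\bigcup_(x in S) (nbhd x :&: U)| < #|G| ->
  7 * (k * (#|S| + k)) <= 2 * #|G| -> #|S| + 4 * k.-1 < #|T| ->
  exists f : G -> H, pack setT f /\ forall x, f x \in U.
Proof.
move=> k0 kn sparse GU alphaU SU degY room1 room2 bigT.
have cardY : #|U :\: S| + #|S| = #|U|.
  by rewrite addnC -(cardsID S U) (setIidPr SU).
have [x safex] : exists x, x \in safe U S.
  apply/set0Pn; rewrite -card_gt0.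
  have := cardsID (\bigcup_(x in S) (nbhd x :&: U)) (U :\: S).
  have := subset_leq_card (subsetIr (U :\: S) (\bigcup_(x in S) (nbhd x :&: U))).
  by rewrite -/(safe U S); lia.
have [Yx noS] := safeP safex.
pose B := nbhd x :&: U.
have BY : B = nbhd x :&: (U :\: S) by apply: nbhd_safe.
have cardB : #|B| <= k.-1 by rewrite BY degY.
have xB : x \notin B by rewrite !inE adj_irr.
have [I0 [stI0 cardI0 I0v]] := stable_del_cnbhd v.
(* As many points of B as possible are covered by an independent set. *)
have [I II0 cardI] := subset_of_card (geq_minr #|B| #|I0|).
have Iv z : z \in I -> z \notin cnbhd v by move/(subsetP II0)/I0v.
have vI : v \notin I by apply/negP => /Iv; rewrite !inE eqxx.
have [g0 [injg0 g0B]] : exists g : G -> H,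
    {in I &, injective g} /\ {in I, forall z, g z \in B}.
  by apply: (injection_into x); rewrite cardI geq_minl.
pose f0 := [eta g0 with v |-> x].
have packI : pack I g0.
  split=> // z1 z2 /(subsetP II0) I1 /(subsetP II0) I2.
  by move/'forall_in_'forall_in_negP: stI0 => /(_ z1 I1 z2 I2) + z12 => /(_ z12).
have pack0 : pack (v |: I) f0.
  apply: pack_extend => //.
    by apply/imsetP=> -[z /g0B Bz xz]; rewrite -xz (negbTE xB) in Bz.
  by move=> z /Iv + zv; rewrite !inE negb_or adj_sym zv andbF.
have f0I : {in I, forall z, f0 z \in B}.
  by move=> z Iz /=; case: eqP => [zv|_]; [rewrite -zv Iz in vI | apply: g0B].
have f0v : f0 v = x by rewrite /= eqxx.
have f0Y : {in v |: I, forall z, f0 z \in U :\: S}.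
  move=> z /setU1P[->|/f0I]; first by rewrite f0v.
  by rewrite BY inE => /andP[].
have cardA : #|v |: I| = #|I|.+1 by rewrite cardsU1 vI.
have IB : #|I| <= #|B| by rewrite cardI geq_minl.
have disjT : [disjoint v |: I & T].
  apply/pred0P=> z /=; apply/negP=> /andP[+ Tz].
  move: Tz; rewrite !inE => /andP[vz _] /orP[/eqP zv|/Iv].
    by rewrite zv adj_irr in vz.
  by rewrite !inE vz orbT.
pose W := ~: (v |: I :|: T).
have cardW : #|W| + #|I|.+1 + #|T| = #|G|.
  have := cardsC (v |: I :|: T); rewrite -/W cardsU disjoint_setI0 // cards0.
  by rewrite cardA; clear; lia.
have [|||||f1 [pack1 f1f0 f1W]] := @pack_greedy_sparse G H k #|G| (#|S| + k)
    (U :\: S) B (v |: I) W f0 k0 kn sparse degY pack0 f0Y.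
- by rewrite -setI_eq0 /W setCU setIA setICr set0I.
- have : #|B :|: f0 @: (v |: I)| <= #|x |: B|.
    apply: subset_leq_card; rewrite subUset subsetUr; apply/subsetP.
    move=> _ /imsetP[z /setU1P[->|/f0I Bz] ->]; first by rewrite f0v setU11.
    by rewrite inE Bz orbT.
  by rewrite cardsU1 xB; move: k0 cardB cardY GU; clear; lia.
- by rewrite cardA; move: k0 cardB IB; clear; lia.
- exact: room2.
- by move: k0 cardB bigT cardW; clear; lia.
have AW : v |: I :|: W = ~: T.
  rewrite /W; move: disjT; set A := v |: I => disjT.
  apply/setP=> z; rewrite in_setU !in_setC in_setU.
  by have [/(disjointFr disjT) ->|] := boolP (z \in A).
rewrite AW in pack1.
have vT : v \in ~: T by rewrite -AW !inE eqxx.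
have f1v : f1 v = x by rewrite f1f0 ?setU11.
have f1I : f1 @: I \subset B.
  apply/subsetP=> _ /imsetP[z Iz ->].
  by rewrite f1f0 ?f0I // inE Iz orbT.
pose R := (U :\: B) :\: f1 @: (~: T).
(* The hypothesis on alpha pays for the points of B that I does not reach. *)
have cardR : #|T| <= #|R|.
  have sIT : I \subset ~: T by rewrite -AW -setUA subsetU // orbC subsetUl.
  have card1 : #|f1 @: (~: T)| = #|~: T| by apply: card_in_imset; case: pack1.
  have cardI1 : #|f1 @: I| = #|I|.
    apply: card_in_imset => z1 z2 I1 I2.
    by apply: (proj1 pack1); apply: (subsetP sIT).
  have : #|f1 @: I| <= #|B :&: f1 @: (~: T)|.
    by apply: subset_leq_card; rewrite subsetI f1I imsetS.
  have := cardsU B (f1 @: (~: T)).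
  have : #|U| <= #|R| + #|B :|: f1 @: (~: T)|.
    have := cardsID (B :|: f1 @: (~: T)) U; rewrite -setDDl -/R.
    have := subset_leq_card (subsetIr U (B :|: f1 @: (~: T))); clear; lia.
  have := subset_leq_card (subsetIl B (f1 @: (~: T))).
  have := cardsC T; move: card1 cardI1 cardI cardI0 cardB GU alphaU; clear; lia.
have [g [injg gR]] := injection_into x cardR.
pose f2 z := if z \in T then g z else f1 z.
have f1U z : z \notin T -> f1 z \in U.
  move=> Tz; suff : f1 z \in U :\: S by rewrite inE => /andP[].
  have : z \in v |: I :|: W by rewrite AW inE Tz.
  rewrite in_setU => /orP[Az|/f1W]; first by rewrite f1f0 ?f0Y.
  by rewrite inE => /andP[].
have gP z : z \in T -> [/\ g z \in U, ~~ adj x (g z) &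
    forall w, w \notin T -> g z <> f1 w].
  move=> Tz; have := gR z Tz; rewrite in_setD => /andP[gf1].
  rewrite in_setD in_setI inE => /andP[+ Uz].
  rewrite Uz andbT => xz; split=> // w Tw gz; case/negP: gf1; rewrite gz.
  by apply: imset_f; rewrite inE.
have leafv z w : z \in T -> adj z w -> w = v.
  rewrite !inE => /andP[vz /card_le1_eqP degz] zw; apply: degz => //.
    by rewrite inE adj_sym.
  by rewrite inE.
exists f2; split; last first.
  by move=> z; rewrite /f2; case: ifPn => [/gP[]//|/f1U].
have redT z w : z \in T -> adj z w -> ~~ adj (f2 z) (f2 w).
  move=> Tz zw; have wv := leafv z w Tz zw.
  rewrite /f2 Tz wv ifN; last by rewrite inE in vT.
  by rewrite f1v adj_sym; case: (gP z Tz).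
split=> z w _ _; rewrite /f2.
- case: ifPn => Tz; case: ifPn => Tw.
  + exact: injg.
  + by case: (gP z Tz) => _ _ /(_ w Tw).
  + by move/esym; case: (gP w Tw) => _ _ /(_ z Tz).
  + by apply: (proj1 pack1); rewrite inE.
- have [Tz|Tz] := boolP (z \in T); first by move/(redT z w Tz); rewrite /f2 Tz.
  have [Tw|Tw] := boolP (w \in T).
    by rewrite adj_sym => /(redT w z Tw); rewrite /f2 Tw (negbTE Tz) adj_sym.
  by apply: (proj2 pack1); rewrite inE.
Qed.

(** * Structure of sparse connected graphs *)

(** Greedy choice: each chosen vertex discards at most K + 1 vertices. *)
Lemma stable_subset (G : sgraph) (K m : nat) (Q : {set G}) :
  {in Q, forall v, #|nbhd v| <= K} -> K.+1 * m <= #|Q| ->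
  exists L : {set G}, [/\ L \subset Q, stable L & #|L| = m].
Proof.
elim: m Q => [|m IH] Q degQ bigQ.
  exists set0; rewrite sub0set cards0; split=> //.
  by apply/'forall_in_'forall_in_negP => x; rewrite inE.
have [u Qu] : exists u, u \in Q.
  by apply/set0Pn; rewrite -card_gt0; apply: leq_trans bigQ; rewrite muln_gt0.
have [||L [LQ stL cardL]] := IH (Q :\: cnbhd u).
- by move=> v; rewrite inE => /andP[_ /degQ].
- have := cardsID (cnbhd u) Q; rewrite mulnS in bigQ.
  have : #|Q :&: cnbhd u| <= K.+1.
    apply: leq_trans (subset_leq_card (subsetIr _ _)) _.
    by rewrite cardsU1 inE adj_irr add1n ltnS degQ.
  by move: bigQ; lia.
have Lu x : x \in L -> [/\ x \in Q, x != u & ~~ adj u x].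
  by move=> /(subsetP LQ); rewrite !inE negb_or => /andP[/andP[]].
exists (u |: L); split.
- by apply/subsetP=> x /setU1P[->|/Lu[]].
- apply/'forall_in_'forall_in_negP => x /setU1P[->|Lx] y /setU1P[->|Ly].
  + by rewrite adj_irr.
  + by apply/negP; case: (Lu y Ly).
  + by rewrite adj_sym; apply/negP; case: (Lu x Lx).
  + by move/'forall_in_'forall_in_negP: stL; apply.
- by rewrite cardsU1 cardL; case: (boolP (u \in L)) => // /Lu[_ /eqP].
Qed.

Lemma connected_closed (G : sgraph) (A : {set G}) (x : G) :
  connected G -> x \in A -> (forall y z, adj y z -> y \in A -> z \in A) ->
  #|G| <= #|A|.
Proof.
move=> connG Ax closA; apply: subset_leq_card; apply/subsetP=> y _.
suff clos : closed (@adj G) (mem A) by rewrite -(closed_connect clos (connG x y)).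
apply: intro_closed => //; apply: sym_connect_sym.
by move=> a b; apply: adj_sym.
Qed.

Lemma connected_deg_gt0 (G : sgraph) (v : G) :
  connected G -> 1 < #|G| -> 0 < #|nbhd v|.
Proof.
move=> connG; apply: contraTltn; rewrite leqn0 cards_eq0 => /eqP v0.
rewrite -leqNgt -(cards1 v); apply: connected_closed connG (set11 v) _.
move=> y z yz /set1P yv; rewrite yv in yz.
have vz : z \in nbhd v by rewrite inE.
by rewrite v0 inE in vz.
Qed.

Lemma connected_leaves_stable (G : sgraph) (L : {set G}) :
  connected G -> 2 < #|G| -> {in L, forall v, #|nbhd v| <= 1} -> stable L.
Proof.
move=> connG bigG leafL; apply/'forall_in_'forall_in_negP => x Lx y Ly xy.
move: bigG; rewrite ltnNge => /negP; apply.
have -> : 2 = #|[set x; y]|.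
  by rewrite cards2; case: eqP => // xy'; rewrite xy' adj_irr in xy.
apply: connected_closed connG (set21 x y) _ => a b ab.
have leaf u w z : u \in L -> adj u w -> adj u z -> z = w.
  move=> /leafL /card_le1_eqP degu uw uz; apply: degu; first by rewrite inE.
  by rewrite inE.
rewrite !inE => /orP[/eqP|/eqP] def_a; move: ab; rewrite def_a => ab.
  by rewrite (leaf _ _ _ Lx xy ab) eqxx orbT.
by rewrite adj_sym in xy; rewrite (leaf _ _ _ Ly xy ab) eqxx.
Qed.

(** Weighing the vertices shows that most of them have degree 2 and no
    neighbour of degree above 2: the excess of the degrees above 2 is bounded
    by the number of leaves plus what the edge bound leaves over 2n. Some l
    of them, at most a third, form an independent set. As each vertex adjacent
    to one of them has degree at most 2, no vertex sees more than two of
    them. *)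
Lemma sparse_stable (G : sgraph) (l : nat) :
  24 * (\sum_(v : G) #|nbhd v|) <= 50 * #|G| -> (forall v : G, 0 < #|nbhd v|) ->
  #|[set v : G | #|nbhd v| <= 1]| < l -> 12 * l <= #|G| ->
  exists L : {set G}, [/\ stable L, #|L| = l, {in L, forall u, #|nbhd u| <= 2}
    & forall w, #|nbhd w :&: L| <= 2].
Proof.
move=> sparse deg0 few lG.
pose N1 := [set v : G | #|nbhd v| <= 1].
pose T := [set v : G | 2 < #|nbhd v|].
pose Q := ~: (N1 :|: T :|: \bigcup_(w in T) nbhd w).
(* The inequality holds vertex by vertex, with equality for degrees 1, 2 and 3. *)
have count : 4 * (\sum_(v : G) #|nbhd v|) + 4 * #|N1| >=
    8 * #|G| + #|T| + \sum_(w in T) #|nbhd w|.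
  have cardE1 (A : {set G}) : #|A| = \sum_(v : G) (v \in A).
    by rewrite -sum1_card big_mkcond; apply: eq_bigr => v _; case: (v \in A).
  rewrite (cardE1 N1) (cardE1 T) [\sum_(w in T) _]big_mkcond /= -sum1_card.
  rewrite !big_distrr -!big_split /=; apply: leq_sum => v _.
  by have := deg0 v; rewrite !inE; case: (#|nbhd v|) => [|[|[|m]]] //= _; lia.
have bigQ : 3 * l <= #|Q|.
  have := cardsC (N1 :|: T :|: \bigcup_(w in T) nbhd w); rewrite -/Q.
  have [+ _] := leq_card_setU (N1 :|: T) (\bigcup_(w in T) nbhd w).
  have [+ _] := leq_card_setU N1 T.
  have : #|\bigcup_(w in T) nbhd w| <= \sum_(w in T) #|nbhd w|.
    elim/big_rec2: _ => [|w m A _ leAm]; first by rewrite cards0.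
    by apply: leq_trans (leq_card_setU _ _) _; rewrite leq_add2l.
  by move: few count sparse lG; rewrite -/N1; clear; lia.
have QP v : v \in Q -> #|nbhd v| = 2 /\ forall w, adj w v -> #|nbhd w| <= 2.
  rewrite !inE !negb_or -ltnNge -leqNgt -andbA => /and3P[v1 v2 /bigcupP vT].
  split; first by apply/eqP; rewrite eqn_leq v2.
  move=> w wv; rewrite leqNgt; apply/negP=> w3.
  by apply: vT; exists w; rewrite inE.
have [|L [LQ stL cardL]] := @stable_subset G 2 l Q _ bigQ.
  by move=> v /QP[->].
exists L; split=> // [u /(subsetP LQ)/QP[-> //]|w].
have [->|[u]] := set_0Vmem (nbhd w :&: L); first by rewrite cards0.
rewrite !inE => /andP[wu /(subsetP LQ)/QP[_ /(_ w wu)]].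
by apply: leq_trans; apply: subset_leq_card; apply: subsetIl.
Qed.

Lemma alpha'_le (G : sgraph) (v : G) : alpha' G <= alpha (del_cnbhd v).
Proof.
rewrite /alpha' -minEnat -leEnat.
exact: (Order.TotalTheory.bigmin_le #|G| v (fun v => alpha (del_cnbhd v))).
Qed.


(** * Packing a sparse connected graph *)

(** All the numerical requirements of the packing, with k + 1 and t + 1 in the
    role of k and t; l is the size of the reserved set. *)
Lemma room_arith (k t : nat) (l := (t * k.+2 + 4 * k + 2) * k.+1) :
  12 * l <= 28 * t.+1 ^ 2 * k.+1 ^ 3 /\
  t * k.+2 * (t.+1 * k.+2 - 1) + k.+1 * (2 * l) <= 28 * t.+1 ^ 2 * k.+1 ^ 3 /\
  7 * (k.+1 * (t * k.+2 + 2 * l)) <= 2 * (28 * t.+1 ^ 2 * k.+1 ^ 3).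
Proof.
rewrite /l !expnS expn0; split; [|split]; nia.
Qed.

(** A vertex with more than q leaves is a hub. Without hubs, l leaves form a
    reserved set of which no vertex sees more than q; and with fewer than l
    leaves there is a reserved set of vertices of degree 2. The value of l
    makes the absorption work with c = q. *)
Theorem pack_sparse (G H : sgraph) (k t : nat) (U S : {set H}) :
  0 < k -> 0 < t -> connected G -> 28 * t ^ 2 * k ^ 3 <= #|G| ->
  24 * (\sum_(v : G) #|nbhd v|) <= 50 * #|G| ->
  #|G| <= #|U| -> #|G| + k.-1 <= #|U| + alpha' G ->
  {in U, forall x, #|nbhd x :&: U| + 1 < t * k.+1} ->
  S \subset U -> #|S| <= t.-1 * k.+1 ->
  {in U :\: S, forall y, #|nbhd y :&: (U :\: S)| <= k.-1} ->
  exists f : G -> H, pack setT f /\ forall x, f x \in U.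
Proof.
case: k => // k _; case: t => // t _ connG bigG sparse GU alphaU degU SU cardS degY.
rewrite /= in cardS degY alphaU.
pose q := t * k.+2 + 4 * k; pose l := (q + 2) * k.+1.
have [lG [room1 room2]] := room_arith k t.
rewrite -/q -/l in lG room1 room2.
have {}lG := leq_trans lG bigG; have {}room1 := leq_trans room1 bigG.
have {}room2 : 7 * (k.+1 * (t * k.+2 + 2 * l)) <= 2 * #|G|.
  by apply: leq_trans room2 _; rewrite leq_mul2l bigG.
have bigG1 : 28 * k.+1 ^ 3 <= #|G|.
  by apply: leq_trans bigG; rewrite leq_mul2r -{1}(muln1 28) leq_mul2l expn_gt0 orbT.
have ql : q + 2 <= l by rewrite leq_pmulr.
have roomX : #|S| + #|\bigcup_(x in S) (nbhd x :&: U)| <=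
    t * k.+2 * (t.+1 * k.+2 - 1).
  have [m def_m] : exists m, t.+1 * k.+2 = m.+2 by exists (t.+1 * k.+2 - 2); lia.
  rewrite def_m in degU *; rewrite subn1 /=.
  apply: leq_trans (_ : #|S| * m.+1 <= _); last by rewrite leq_mul2r cardS orbT.
  rewrite mulnS leq_add2l mulnC; apply: card_bigcup_leq => x Sx.
  by have := degU x (subsetP SU x Sx); rewrite addn1 !ltnS.
have roomS : 7 * (k.+1 * (#|S| + 2 * l)) <= 2 * #|G|.
  by apply: leq_trans room2; rewrite !leq_mul2l leq_add2r cardS orbT.
pose T (v : G) := [set u in nbhd v | #|nbhd u| <= 1].
have [/existsP[v bigT]|/existsPn noT] := boolP [exists v : G, q < #|T v|].
  have := alpha'_le v => alphav.
  apply: (@pack_of_hub G H k.+1 U S v) => //; rewrite -/(T v).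
  - by apply: leq_trans alphaU _; rewrite leq_add2l.
  - have : 0 < k.+1 * (2 * l) by rewrite !muln_gt0 /=; move: ql; clear; lia.
    by move: roomX room1; clear; lia.
  - apply: leq_trans roomS; rewrite !leq_mul2l leq_add2l.
    by move: ql; rewrite /q; clear; lia.
  - by move: bigT cardS; rewrite /q; clear; lia.
have rooml : #|S| + 3 * k <= l by move: ql cardS; rewrite /q; clear; lia.
have roomSX : #|S| + #|\bigcup_(x in S) (nbhd x :&: U)| + k.+1 * (2 * l) <= #|G|.
  by move: roomX room1; clear; lia.
have bigG3 : 2 < #|G| by move: ql lG; clear; lia.
have [manyN1|fewN1] := leqP l #|[set v : G | #|nbhd v| <= 1]|.
  have [L LN1 cardL] := subset_of_card manyN1.
  have leafL : {in L, forall v, #|nbhd v| <= 1}.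
    by move=> v /(subsetP LN1); rewrite inE.
  apply: (@pack_of_stable G H k.+1 l q U S L) => //.
  - exact: connected_leaves_stable connG bigG3 leafL.
  - by move=> u /leafL /leqW.
  - move=> w; have := noT w; rewrite -leqNgt; apply: leq_trans.
    apply: subset_leq_card; apply/subsetP=> u; rewrite !inE => /andP[-> Lu].
    exact: leafL.
  - by rewrite /l /q /=; clear; nia.
have deg0 (v : G) : 0 < #|nbhd v| by apply: connected_deg_gt0 connG (ltnW bigG3).
have [L [stL cardL deg2 cL]] := sparse_stable sparse deg0 fewN1 lG.
apply: (@pack_of_stable G H k.+1 l 2 U S L) => //.
by rewrite /l /q /=; clear; nia.
Qed.

(** * Disjoint stars *)

(** Disjointness is obtained by taking each star out of U before the next one,
    which suits inductions on the number of stars. The graph H is the blue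
    one. *)
Fixpoint star_family (H : sgraph) (k t : nat) (U : {set H}) : Prop :=
  if t is t'.+1 then
    exists x (B : {set H}), [/\ x \in U, B \subset nbhd x :&: U, #|B| = k &
      star_family k t' (U :\: (x |: B))]
  else True.

Lemma star_family_sub (H : sgraph) (k t : nat) (U V : {set H}) :
  U \subset V -> star_family k t U -> star_family k t V.
Proof.
elim: t U V => //= t IH U V UV [x [B [Ux BU cardB fam]]].
exists x, B; split=> //; first exact: (subsetP UV).
  by apply: subset_trans BU _; apply: setIS.
by apply: IH fam; apply: setSD.
Qed.

Lemma star_family_support (H : sgraph) (k t : nat) (U : {set H}) :
  star_family k t U ->
  exists Z : {set H}, [/\ Z \subset U, #|Z| = t * k.+1 & star_family k t Z].
Proof.
elim: t U => [|t IH] U /=; first by exists set0; rewrite sub0set cards0.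
move=> [x [B [Ux BU cardB /IH[Z [ZU cardZ fam]]]]].
have xB : x \notin B.
  by apply/negP=> /(subsetP BU); rewrite !inE adj_irr.
have disj : [disjoint x |: B & Z].
  rewrite disjoint_sym disjoints_subset; apply/subsetP=> y /(subsetP ZU).
  by rewrite in_setD in_setC => /andP[].
exists (x |: B :|: Z); split.
- rewrite !subUset sub1set Ux (subset_trans BU (subsetIr _ _)).
  exact: subset_trans ZU (subsetDl _ _).
- by rewrite cardsU disjoint_setI0 // cards0 cardsU1 xB cardB cardZ mulSn subn0.
- exists x, B; split=> //; first by rewrite !inE eqxx.
    rewrite subsetI (subset_trans BU (subsetIl _ _)) /=.
    by rewrite -setUA setUCA subsetUl.
  apply: star_family_sub fam; rewrite subsetD subsetUr /=.
  by rewrite disjoint_sym.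
Qed.

(** Take out stars as long as possible: what they cover is S. Fewer than t of
    them can be found, and in what remains no vertex is the centre of a star. *)
Lemma star_family_maximal (H : sgraph) (k t : nat) (U : {set H}) :
  ~ star_family k t U ->
  exists S : {set H}, [/\ S \subset U, #|S| <= t.-1 * k.+1 &
    {in U :\: S, forall y, #|nbhd y :&: (U :\: S)| < k}].
Proof.
elim: t U => [|t IH] U; first by case.
have [/exists_inP[x Ux bigx]|/exists_inPn small] :=
    boolP [exists x in U, k <= #|nbhd x :&: U|]; last first.
  exists set0; rewrite sub0set cards0 setD0; split=> // y Uy.
  by rewrite ltnNge small.
have [B BU cardB] := subset_of_card bigx => nofam.
have [|S [SU cardS degS]] := IH (U :\: (x |: B)).
  by move=> fam; apply: nofam; exists x, B.
case: t IH nofam cardS => [_|t _ _ cardS]; first by case; exists x, B.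
exists (x |: B :|: S); split.
- rewrite !subUset sub1set Ux (subset_trans BU (subsetIr _ _)).
  exact: subset_trans SU (subsetDl _ _).
- have [cardxBS _] := leq_card_setU (x |: B) S; apply: leq_trans cardxBS _.
  rewrite mulSn leq_add //.
  by apply: leq_trans (leq_card_setU _ _) _; rewrite cards1 cardB.
- by rewrite -setDDl.
Qed.

(** A family of t stars needs only t(k+1) vertices, so x has k neighbours off
    them. *)
Lemma star_family_extend (H : sgraph) (k t : nat) (U : {set H}) (x : H) :
  x \in U -> t.+1 * k.+1 <= #|nbhd x :&: U| + 1 ->
  star_family k t (U :\ x) -> star_family k t.+1 U.
Proof.
move=> Ux degx /star_family_support[Z [ZU cardZ fam]].
have : k <= #|(nbhd x :&: U) :\: Z|.
  have := cardsID Z (nbhd x :&: U).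
  have := subset_leq_card (subsetIr (nbhd x :&: U) Z).
  by move: degx cardZ; rewrite mulSn; clear; lia.
move=> /subset_of_card[B BU cardB]; exists x, B; split=> //.
  exact: subset_trans BU (subsetDl _ _).
apply: star_family_sub fam; apply/subsetP=> z Zz.
have := subsetP ZU z Zz; rewrite !inE => /andP[/negbTE -> ->]; rewrite andbT.
by apply: contraL Zz => /(subsetP BU); rewrite inE => /andP[].
Qed.

Lemma star_family_copies (H : sgraph) (k t : nat) (U : {set H}) :
  star_family k t U ->
  exists f : 'I_t * option 'I_k -> H, [/\ injective f, forall p, f p \in U &
    forall p q : copies t (star k), adj p q -> adj (f p) (f q)].
Proof.
elim: t U => [|t IH] U /=.
  have none (p : 'I_0 * option 'I_k) : False by case: p => -[].
  by exists (fun p => False_rect H (none p)); split=> [p|p|p]; case: (none p).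
move=> [x [B [Ux BU cardB /IH[f [injf fU adjf]]]]].
pose leaf (a : 'I_k) : H := enum_val (cast_ord (esym cardB) a).
have injleaf : injective leaf by move=> a b /enum_val_inj /cast_ord_inj.
have leafB a : leaf a \in B by apply: enum_valP.
have xleaf a : adj x (leaf a).
  by have := subsetP BU _ (leafB a); rewrite !inE => /andP[].
pose first o := if o is Some a then leaf a else x.
have firstB o : first o \in x |: B.
  by case: o => [a|]; rewrite /= !inE ?leafB ?orbT ?eqxx.
have fP p : f p \in U /\ f p \notin x |: B.
  by have := fU p; rewrite in_setD => /andP[].
have f_first p o : f p <> first o.
  by move=> fo; case: (fP p) => _; rewrite fo firstB.
exists (fun p => if unlift ord0 p.1 is Some i then f (i, p.2) else first p.2).
split=> [[i o] [j o'] /=|[i o] /=|[i o] [j o'] /=].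
- case: unliftP => [i'|] ->; case: unliftP => [j'|] -> //.
  + by move/injf => [-> ->].
  + by move/f_first.
  + by move/esym/f_first.
  + case: o o' => [a|] [b|] //= => [/injleaf -> //|ax|xb].
      by have := xleaf a; rewrite ax adj_irr.
    by have := xleaf b; rewrite -xb adj_irr.
- case: unliftP => [i'|] _; first by case: (fP (i', o)).
  case: o => [a|] //=; have := subsetP BU _ (leafB a).
  by rewrite inE => /andP[].
- move=> /andP[/eqP /= <-]; case: unliftP => [i'|] _ oo'.
    by apply: adjf; rewrite /= eqxx.
  have {oo'} : isSome o (+) isSome o' by exact: oo'.
  by case: o o' => [a|] [b|] //= _; rewrite adj_sym.
Qed.

(** * The Ramsey number *)

(** Deleting a vertex of large degree in H costs one point of U and one star,
    and one point per star is what the bound allows for. *)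
Lemma pack_or_stars (G H : sgraph) (k t : nat) (U : {set H}) :
  0 < k -> connected G -> 28 * t ^ 2 * k ^ 3 <= #|G| ->
  24 * (\sum_(v : G) #|nbhd v|) <= 50 * #|G| ->
  maxn #|G| (#|G| + k - 1 - alpha' G) + t <= #|U| + 1 ->
  (exists f : G -> H, pack setT f /\ forall x, f x \in U) \/ star_family k t U.
Proof.
move=> k0 connG + sparse; elim: t U => [|t IH] U bigG cardU; first by right.
have [/exists_inP[x Ux degx]|/exists_inPn degU] :=
    boolP [exists x in U, t.+1 * k.+1 <= #|nbhd x :&: U| + 1].
  have [|||] := IH (U :\ x).
  - apply: leq_trans bigG; rewrite leq_mul2r leq_mul2l leq_exp2r // leqnSn.
    by rewrite !orbT.
  - by move: cardU; rewrite (cardsD1 x U) Ux; clear; lia.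
  - move=> [f [packf fU]]; left; exists f; split=> // y.
    by have := fU y; rewrite inE => /andP[].
  - by move=> fam; right; apply: star_family_extend fam.
have [fam|/star_family_maximal[S [SU cardS degS]]] := pselect (star_family k t.+1 U).
  by right.
left; apply: (@pack_sparse G H k t.+1 U S) => //.
- by move: cardU; clear; lia.
- by move: cardU k0; clear; lia.
- by move=> x Ux; rewrite ltnNge degU.
- by move=> y /degS; rewrite -(prednK k0) ltnS.
Qed.

Lemma sum_deg_le (G : sgraph) : \sum_(v : G) #|nbhd v| <= 2 * #|edges G|.
Proof.
have -> : \sum_(v : G) #|nbhd v| = \sum_(p : G * G | adj p.1 p.2) 1.
  under eq_bigr => v _ do rewrite -sum1_card.
  rewrite pair_big_dep /=; apply: eq_bigl => p.
  by rewrite inE.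
rewrite (partition_big (fun p : G * G => [set p.1; p.2]) (mem (edges G))) /=;
  last by move=> p adjp; apply/imsetP; exists p; rewrite ?inE.
rewrite mulnC -sum_nat_const; apply: leq_sum => e /imsetP[[x y] _ ->] /=.
rewrite sum1_card; apply: leq_trans (_ : #|[set (x, y); (y, x)]| <= 2); last first.
  by rewrite cards2; case: (_ != _).
apply: subset_leq_card; apply/subsetP=> -[a b]; rewrite !inE /=.
move=> /andP[ab /eqP eqab].
have : b \in [set x; y] by rewrite -eqab set22.
have : a \in [set x; y] by rewrite -eqab set21.
rewrite !inE !xpair_eqE => /orP[]/eqP eqa /orP[]/eqP eqb; subst;
  by rewrite ?adj_irr ?eqxx ?orbT in ab *.
Qed.

(** Since tk >= k >= 1, g(k,t) >= 21tk - 3k + 6 >= 18k + 6 >= 24. *)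
Lemma sparse_sum_deg (G : sgraph) (k t : nat) : 0 < k -> 0 < t ->
  (#|edges G|%:R <= #|G|%:R * (1 + (g k t)%:R^-1) :> rat)%R ->
  24 * (\sum_(v : G) #|nbhd v|) <= 50 * #|G|.
Proof.
move=> k0 t0 hE.
have g24 : 24 <= g k t.
  have : k <= t * k by rewrite leq_pmull.
  by rewrite /g leq_max -!mulnA; lia.
have edges24 : 24 * #|edges G| <= 25 * #|G|.
  rewrite -(ler_nat rat) !natrM.
  have ginv : ((g k t)%:R^-1 <= 24%:R^-1 :> rat)%R.
    by rewrite lef_pV2 ?posrE ?ltr0n ?ler_nat //; apply: leq_trans g24.
  have : (#|G|%:R * (1 + (g k t)%:R^-1) <= #|G|%:R * (1 + 24%:R^-1) :> rat)%R.
    by apply: ler_wpM2l; rewrite ?ler0n ?lerD2l.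
  by move: hE; lra.
by have := sum_deg_le G; lia.
Qed.

Lemma ramsey_le (G H : sgraph) (N : nat) : ramsey_prop G H N -> ramsey G H <= N.
Proof.
by move=> propN; rewrite /ramsey; case: ex_minnP => m _; apply; apply/asboolP.
Qed.

Lemma pack_subgraph (G F : sgraph) (f : G -> compl F) :
  pack setT f -> subgraph G F.
Proof.
move=> [injf redf]; exists f; split=> [x y|x y xy].
  by apply: injf; rewrite inE.
have := redf x y (in_setT x) (in_setT y) xy.
rewrite negb_and !negbK => /orP[/eqP fxy|//].
have xy' : x = y by apply: injf fxy; rewrite inE.
by rewrite xy' adj_irr in xy.
Qed.

Definition two_cliques_adj (a N : nat) : rel 'I_N :=
  fun x y => (x != y) && ((x < a) == (y < a)).

Fact two_cliques_sym (a N : nat) : symmetric (@two_cliques_adj a N).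
Proof. by move=> x y; rewrite /two_cliques_adj eq_sym [(x < a) == _]eq_sym. Qed.

Fact two_cliques_irr (a N : nat) : irreflexive (@two_cliques_adj a N).
Proof. by move=> x; rewrite /two_cliques_adj eqxx. Qed.

Definition two_cliques (a N : nat) : sgraph :=
  SGraph (@two_cliques_sym a N) (@two_cliques_irr a N).

(** No edge of G can lead from one clique to the other, so a connected G stays
    in the clique of any of its vertices. *)
Lemma two_cliques_connected (G : sgraph) (a N : nat) :
  connected G -> subgraph G (two_cliques a N) -> #|G| <= maxn a (N - a).
Proof.
move=> connG [f [injf adjf]].
have sameside x y : (val (f x) < a) = (val (f y) < a).
  have clos : closed (@adj G) [pred z | val (f z) < a].
    by move=> u w /adjf /andP[_ /eqP].
  by have := closed_connect clos (connG x y); rewrite !inE.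
have [x xa|noa] := pickP [pred x | val (f x) < a].
  have fa y : val (f y) < a by rewrite -(sameside x).
  rewrite leq_max -[X in _ <= X](card_ord a) (leq_card (fun y => Ordinal (fa y))) //.
  by move=> y z [/val_inj/injf].
have fa y : a <= val (f y) by rewrite leqNgt (negbT (noa y)).
have faN y : val (f y) - a < N - a.
  by apply: ltn_sub2r; [apply: leq_ltn_trans (fa y) _|]; apply: ltn_ord.
rewrite leq_max orbC -[X in _ <= X](card_ord (N - a)).
rewrite (leq_card (fun y => Ordinal (faN y))) // => y z [eqyz].
by apply/injf/val_inj; move: eqyz (fa y) (fa z) => /=; clear; lia.
Qed.

(** An edge of the complement joins the two cliques, so each star has a vertex
    in the second one, and t disjoint stars need t such vertices. *)
Lemma two_cliques_no_stars (k t a N : nat) :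
  0 < k -> 0 < t -> N < a + t ->
  ~ subgraph (copies t (star k)) (compl (two_cliques a N)).
Proof.
move=> k0 t0 Nat [f [injf adjf]].
pose leaf0 : 'I_k := Ordinal k0.
have side i : exists o : option 'I_k, a <= val (f (i, o)).
  have /andP[ne] : adj (f (i, None)) (f (i, Some leaf0)).
    by apply: adjf; rewrite /= eqxx.
  rewrite negb_and ne /= => sides.
  have [big|small] := leqP a (val (f (i, None))); first by exists None.
  by exists (Some leaf0); rewrite leqNgt; move: sides; rewrite small; case: (_ < a).
pose o i : option 'I_k := xchoose (side i).
have oP i : a <= val (f (i, o i)) := xchooseP (side i).
have oN i : val (f (i, o i)) - a < N - a.
  by apply: ltn_sub2r; [apply: leq_ltn_trans (oP i) _|]; apply: ltn_ord.
have : #|'I_t| <= #|'I_(N - a)|.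
  apply: (leq_card (fun i => Ordinal (oN i))) => i j [eqij].
  have : f (i, o i) = f (j, o j).
    by apply/val_inj; move: eqij (oP i) (oP j) => /=; clear; lia.
  by move/injf => [].
by rewrite !card_ord; lia.
Qed.

Lemma ramsey_lower (G : sgraph) (k t : nat) : 0 < k -> 0 < t -> t <= #|G| ->
  connected G -> #|G| + t - 1 <= ramsey G (copies t (star k)).
Proof.
move=> k0 t0 tG connG; rewrite /ramsey; case: ex_minnP => N /asboolP[N0 propN] _.
rewrite leqNgt; apply/negP=> ltN.
have [|/(two_cliques_connected connG)|] := propN (two_cliques (#|G| - 1) N).
- exact: card_ord.
- by rewrite leqNgt gtn_max; move: ltN tG t0; clear; lia.
- by apply: two_cliques_no_stars => //; move: ltN tG t0; clear; lia.
Qed.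

Theorem theorem5 (k t n : nat) (hk : 1 <= k) (ht : 1 <= t)
    (hn : 28 * t ^ 2 * k ^ 3 <= n)
    (G : sgraph) (hG : connected G) (hV : #|G| = n)
    (hE : (#|edges G|%:R <= n%:R * (1 + (g k t)%:R^-1) :> rat)%R) :
  ramsey G (copies t (star k)) <= maxn n (n + k - 1 - alpha' G) + t - 1 /\
  (k - 1 <= alpha' G -> ramsey G (copies t (star k)) = n + t - 1).
Proof.
subst n; have sparse := sparse_sum_deg hk ht hE.
have tG : t <= #|G|.
  apply: leq_trans hn; rewrite -[X in X <= _]muln1 leq_mul ?expn_gt0 ?hk //.
  by rewrite expnS expn1 mulnA leq_pmull // muln_gt0.
have upper : ramsey G (copies t (star k)) <=
    maxn #|G| (#|G| + k - 1 - alpha' G) + t - 1.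
  apply: ramsey_le; split.
    by have := leq_maxl #|G| (#|G| + k - 1 - alpha' G); move: tG ht; clear; lia.
  move=> F cardF; have cardU := cardsT (compl F); rewrite [RHS]cardF in cardU.
  have [|[f [/pack_subgraph Gf _]]|/star_family_copies[f [injf _ adjf]]] :=
      @pack_or_stars G (compl F) k t setT hk hG hn sparse.
  - by rewrite cardU; move: ht; clear; lia.
  - by left.
  - by right; exists f.
split=> // alphak; apply/eqP; rewrite eqn_leq ramsey_lower // andbT.
apply: leq_trans upper _; rewrite (maxn_idPl _) //.
by move: alphak hk; clear; lia.
Qed.
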